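(* Let $\lambda_1\ge\lambda_2\ge2$ and $h_1\ge h_2\ge 2$ be integers and let $\lambda=(\lambda_1,\lambda_2,2^{h_2-2},1^{h_1-h_2})$, a partition of $n=\lambda_1+\lambda_2+h_1+h_2-4$. If $h_1\le m\le n-(\lambda_1-1)$, then $$|\mathrm{QYT}_{=m}(\lambda)|=\frac{\lambda_1-\lambda_2+1}{m-h_2+1}\binom{\lambda_1+h_1-2}{m-h_2}\binom{\lambda_2+h_1-3}{m-h_2}\binom{m-h_2}{m-h_1}\binom{\lambda_2+h_2-4}{h_2-2}\binom{\lambda_1+h_2-3}{h_2-2}\frac{1}{\binom{h_1-1}{h_2-2}}.$$
   Context: The notation $(\lambda_1,\lambda_2,2^{h_2-2},1^{h_1-h_2})$ denotes the partition with rows of lengths $\lambda_1,\lambda_2$, followed by $h_2-2$ rows of length $2$, followed by $h_1-h_2$ rows of length $1$; it has Durfee size $2$, first column of height $h_1$ and second column of height $h_2$. The (French) Young diagram has $\lambda_j$ left-justified boxes in row $j$, rows numbered from bottom to top. A semistandard Young tableau (SSYT) of shape $\lambda$ is a filling of the boxes with positive integers weakly increasing left to right along rows and strictly increasing bottom to top along columns. An SSYT $T$ is quasi-Yamanouchi if for every integer $i>1$ appearing in $T$, the leftmost occurrence of $i$ lies in a column weakly left of (column index $\le$) some occurrence of $i-1$. $\mathrm{QYT}_{=m}(\lambda)$ is the set of quasi-Yamanouchi tableaux of shape $\lambda$ whose largest entry is exactly $m$. *)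

(* Defs.v *)
From mathcomp Require Import all_boot all_order all_algebra.
Set Implicit Arguments. Unset Strict Implicit. Unset Printing Implicit Defensive.

(* A partition is a weakly decreasing seq of row lengths lam = [:: lam_1; lam_2; ...].
   Cells are pairs (row, column), 0-indexed; row 0 is the bottom row (French).
   Cell (i, j) belongs to the diagram iff i < size lam and j < lam_(i+1). *)
Definition in_shape (lam : seq nat) (i j : nat) : bool :=
  (i < size lam) && (j < nth 0 lam i).

(* A filling with entries bounded by m is a finite function on the bounding
   rectangle (size lam rows, head lam = lam_1 columns) with values in 0..m;
   cells outside the diagram carry the dummy value 0, so such fillings are in
   bijection with fillings of the diagram by {1..m}. *)
Definition filling (lam : seq nat) (m : nat) :=
  {ffun 'I_(size lam) * 'I_(head 0 lam) -> 'I_m.+1}.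

Definition ins (lam : seq nat) (x : 'I_(size lam) * 'I_(head 0 lam)) : bool :=
  in_shape lam x.1 x.2.

Definition is_QYT_eq (lam : seq nat) (m : nat) (T : filling lam m) : bool :=
  [&&
      [forall x, ~~ ins x ==> (nat_of_ord (T x) == 0)],
      [forall x, ins x ==> (0 < T x)],
      [forall x, forall y,
          [&& ins x, ins y, x.1 == y.1 & (x.2 < y.2)%N] ==> (T x <= T y)%N],
      [forall x, forall y,
          [&& ins x, ins y, x.2 == y.2 & (x.1 < y.1)%N] ==> (T x < T y)%N],
      (* largest entry is exactly m (all entries are <= m by typing) *)
      [exists x, ins x && (nat_of_ord (T x) == m)] &
      [forall i : 'I_m.+1,
          ((1 < i)%N && [exists x, ins x && (T x == i)]) ==>
          [exists x, [&& ins x, T x == i,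
              [forall y, (ins y && (T y == i)) ==> (x.2 <= y.2)%N] &
              [exists z, [&& ins z, nat_of_ord (T z) == i.-1 & (x.2 <= z.2)%N]]]]]].

Definition QYT_eq_card (lam : seq nat) (m : nat) : nat :=
  #|[pred T : filling lam m | is_QYT_eq T]|.

Definition hook2 (l1 l2 h1 h2 : nat) : seq nat :=
  [:: l1; l2] ++ nseq (h2 - 2) 2 ++ nseq (h1 - h2) 1.

(* Main.v *)
Require Import Defs.
From mathcomp Require Import all_boot all_order all_algebra.
From mathcomp Require Import zify ring.
Set Implicit Arguments. Unset Strict Implicit. Unset Printing Implicit Defensive.
Import Order.TTheory GRing.Theory Num.Theory.

(** Let [T] be quasi-Yamanouchi with largest entry [m] and let [c] be the corner of its
rightmost [m]. Erasing [c] gives a quasi-Yamanouchi tableau with largest entry [m - 1]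
whose rightmost [m - 1] is weakly right of [c], or one with largest entry [m] whose
rightmost [m] is strictly left of [c], and both cases are reversible. For a diagram with
Frobenius coordinates [(a1, a2 | b1, b2)] the corners, from right to left, sit at the ends of
the arms [a1], [a2] and of the legs [b2], [b1]; a rightmost [m] on arm [a1] (resp. leg [b1])
imposes no condition on the smaller tableau, and one on [a2] (resp. [b2]) only distinguishes
whether the next rightmost entry lies on [a1] (resp. [b1]). The numbers [f(m)] of
tableaux therefore satisfy a linear recurrence without refinement. Writing [L - x] for the
diagram [L] with [x] shortened by one cell,
  [f_L(m) = f_(L-a1)(m) + f_(L-b1)(m-1)
     + f_(L-b2)(m-1) - f_(L-b1-b2)(m-2) + f_(L-b1-b2)(m-1)
     + f_(L-a1-a2)(m-1) + f_(L-a2)(m) - f_(L-a1-a2)(m)].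
It is solved by [(a1-a2) (b1-b2) prod (ai+bj)! / (prod ai! bj! (d-bj)! (e-ai)!)], where
[d = m - 1] and [d + e + 1] is the number of cells. When [a2 = b2 = 0] the inner corner
belongs to both [a2] and [b2], and its removal leaves a hook. *)

(** * Tableaux *)

Section Tableaux.
Variables R C M : nat.
Local Notation cell := ('I_R * 'I_C)%type.
Local Notation tableau := {ffun cell -> 'I_M.+1}.
Implicit Types (S : {set cell}) (T : tableau) (c x y z : cell) (i k m v : nat).

Lemma cell_eqE x y : (x == y) = (x.1 == y.1 :> nat) && (x.2 == y.2 :> nat).
Proof. by rewrite -pair_eqE. Qed.

Definition left_of x y : bool := (x.1 == y.1 :> nat) && (x.2 < y.2).
Definition below x y : bool := (x.2 == y.2 :> nat) && (x.1 < y.1).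

Definition monotone_along (r : rel cell) (leT : rel nat) S T : bool :=
  [forall x in S, forall y in S, r x y ==> leT (T x) (T y)].

Lemma monotone_alongP (r : rel cell) (leT : rel nat) S T :
  reflect {in S &, forall x y, r x y -> leT (T x) (T y)} (monotone_along r leT S T).
Proof.
apply: (iffP forall_inP) => [mono x y xS yS | mono x xS].
  by have /forall_inP/(_ y yS)/implyP := mono x xS.
by apply/forall_inP=> y yS; apply/implyP; apply: mono.
Qed.

Definition semistandard S T : bool :=
  [&& [forall x, (0 < T x) == (x \in S)], monotone_along left_of leq S T
    & monotone_along below ltn S T].

Lemma semistandardP S T :
  reflect [/\ forall x, (0 < T x) = (x \in S), monotone_along left_of leq S T
            & monotone_along below ltn S T]
          (semistandard S T).
Proof.
apply: (iffP and3P) => -[supp row col]; split=> //.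
  by move=> x; move/forallP/(_ x)/eqP: supp.
by apply/forallP=> x; rewrite supp.
Qed.

(* The entry [0] is deemed to reach every column, so that [linked] makes no exception for [1]. *)
Definition reaches k i T : bool :=
  (i == 0) || [exists z, (T z == i :> nat) && (k <= z.2)].

Lemma reachesP k i T :
  reflect (i = 0 \/ exists2 z, T z = i :> nat & k <= z.2) (reaches k i T).
Proof.
apply: (iffP orP) => -[].
- by move/eqP; left.
- by case/existsP=> z /andP[/eqP Tz kz]; right; exists z.
- by move=> ->; left.
- by case=> z Tz kz; right; apply/existsP; exists z; rewrite Tz eqxx.
Qed.

Lemma reaches_leq j k i T : j <= k -> reaches k i T -> reaches j i T.
Proof.
move=> jk /reachesP[->//|[z Tz kz]]; apply/reachesP; right.
by exists z; rewrite ?(leq_trans jk).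
Qed.

(* Besides the quasi-Yamanouchi condition at [i.+1], this says that [1], ..., [m] all occur. *)
Definition linked m T : bool :=
  [forall i : 'I_m, exists x, (T x == i.+1 :> nat) && reaches x.2 i T].

Lemma linkedP m T :
  reflect (forall i, i < m -> exists2 x, T x = i.+1 :> nat & reaches x.2 i T) (linked m T).
Proof.
apply: (iffP forallP) => [link i im | link i].
  by have /existsP[x /andP[/eqP Tx]] := link (Ordinal im); exists x.
by have [x Tx rx] := link i (ltn_ord i); apply/existsP; exists x; rewrite Tx eqxx.
Qed.

Definition qyt S m T : bool :=
  [&& semistandard S T, [forall x, T x <= m] & linked m T].

Lemma qytP S m T :
  reflect [/\ semistandard S T, forall x, T x <= m & linked m T] (qyt S m T).
Proof. by apply: (iffP and3P) => -[sT /forallP]. Qed.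

Lemma qyt_support S m T x : qyt S m T -> (0 < T x) = (x \in S).
Proof. by case/qytP=> /semistandardP[]. Qed.

Lemma qyt_max_occurs S m T : qyt S m T -> 0 < m -> exists x, T x = m :> nat.
Proof.
by case/qytP=> _ _ /linkedP; case: m => // m /(_ m (ltnSn m))[x Tx _] _; exists x.
Qed.

Lemma qyt0_eq_set0 S T : qyt S 0 T -> S = set0.
Proof.
move=> qT; apply/setP=> x; rewrite inE -(qyt_support x qT).
by case/qytP: qT => _ /(_ x); rewrite leqn0 => /eqP->.
Qed.

Definition rightmost c m T : bool :=
  (T c == m :> nat) && [forall x, (T x == m :> nat) && (x != c) ==> (x.2 < c.2)].

Lemma rightmostP c m T :
  reflect (T c = m :> nat /\ forall x, T x = m :> nat -> x != c -> x.2 < c.2)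
          (rightmost c m T).
Proof.
apply: (iffP andP) => -[/eqP Tc right]; split=> //.
  by move=> x /eqP Tx xc; have /forallP/(_ x) := right; rewrite Tx xc.
by apply/forallP=> x; apply/implyP=> /andP[/eqP]; apply: right.
Qed.

Lemma reaches_rightmost c k m T : 0 < m -> rightmost c m T -> reaches k m T = (k <= c.2).
Proof.
move=> m_gt0 /rightmostP[Tc right]; apply/reachesP/idP => [[m0|[z Tz kz]]|kc].
- by rewrite m0 in m_gt0.
- have [<-//|/(right _ Tz) /ltnW] := eqVneq z c.
  exact: leq_trans.
- by right; exists c.
Qed.

Lemma rightmost_unique c c' m T : rightmost c m T -> rightmost c' m T -> c = c'.
Proof.
move=> /rightmostP[Tc right] /rightmostP[Tc' right']; apply/eqP/negPn/negP => neq.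
have := right' c Tc neq; rewrite ltnNge ltnW // right //.
by rewrite eq_sym.
Qed.

Lemma rightmost_exists S m T : qyt S m T -> 0 < m -> exists c, rightmost c m T.
Proof.
move=> qT m_gt0.
have [x0 /eqP Tx0] := qyt_max_occurs qT m_gt0.
have [c /eqP Tc cmax] := @arg_maxnP _ x0 (fun x => T x == m :> nat) (fun x => x.2) Tx0.
exists c; apply/rightmostP; split=> // x Tx neq_xc.
rewrite ltn_neqAle [_ <= _]cmax ?Tx // andbT; apply/eqP => same_col.
have [xS cS] : x \in S /\ c \in S by rewrite -!(qyt_support _ qT) Tx Tc.
have /qytP[/semistandardP[_ _ /monotone_alongP col] _ _] := qT.
have [lt_row|lt_row|same_row] := ltngtP x.1 c.1.
- by have := col x c xS cS; rewrite /below /= same_col eqxx lt_row Tx Tc ltnn => /(_ isT).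
- by have := col c x cS xS; rewrite /below /= same_col eqxx lt_row Tx Tc ltnn => /(_ isT).
- by case/eqP: neq_xc; apply/eqP; rewrite cell_eqE same_row same_col !eqxx.
Qed.

(* [S] need not be a diagram: only the row and the column of [c] are inspected. *)
Definition corner S c : Prop :=
  [/\ c \in S, {in S, forall x, ~~ left_of c x} & {in S, forall x, ~~ below c x}].

Lemma corner_neq0 S c : corner S c -> S != set0.
Proof. by case=> cS _ _; apply/set0Pn; exists c. Qed.

Lemma corner_col_inj S c c' : corner S c -> corner S c' -> c.2 = c'.2 -> c = c'.
Proof.
move=> [cS _ /(_ c') top] [c'S _ /(_ c) top'] same_col; apply/eqP; rewrite cell_eqE.
by move: (top c'S) (top' cS); rewrite /below same_col !eqxx /= -!leqNgt andbT eqn_leq => -> ->.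
Qed.

Lemma rightmost_corner S c m T : qyt S m T -> rightmost c m T -> 0 < m -> corner S c.
Proof.
move=> qT /rightmostP[Tc right] m_gt0.
have /qytP[/semistandardP[supp /monotone_alongP row /monotone_alongP col] Tm _] := qT.
have cS : c \in S by rewrite -supp Tc.
split=> // x xS; apply/negP => cx; last first.
  by have := col c x cS xS cx; rewrite /= Tc ltnNge Tm.
have /andP[_ lt_cx] := cx; have Tx : T x = m :> nat.
  by apply/eqP; rewrite eqn_leq Tm -{1}Tc (row c x).
have neq_xc : x != c by apply: contraTneq lt_cx => ->; rewrite ltnn.
by have := right _ Tx neq_xc; rewrite ltnNge ltnW.
Qed.

Definition set_entry T c v : tableau := [ffun x => if x == c then inord v else T x].

Lemma set_entry_same T c v : v <= M -> set_entry T c v c = v :> nat.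
Proof. by move=> vM; rewrite ffunE eqxx inordK. Qed.

Lemma set_entry_other T c v x : x != c -> set_entry T c v x = T x.
Proof. by rewrite ffunE => /negPf->. Qed.

Lemma set_entryK T c v w : T c = w :> nat -> set_entry (set_entry T c v) c w = T.
Proof.
move=> <-; apply/ffunP=> x; rewrite ffunE.
by have [->|xc] := eqVneq x c; rewrite ?inord_val ?set_entry_other.
Qed.

Section Insertion.
Variables (S : {set cell}) (c : cell) (T : tableau).
Hypotheses (cornerSc : corner S c) (Tc0 : T c = 0 :> nat).

Lemma monotone_along_set_entry (r : rel cell) (leT : rel nat) v : v <= M ->
  c \in S -> {in S, forall x, ~~ r c x} ->
  monotone_along r leT S (set_entry T c v) <->
  monotone_along r leT (S :\ c) T /\ {in S :\ c, forall x, r x c -> leT (T x) v}.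
Proof.
move=> vM cS r_max; split=> [/monotone_alongP mono | [/monotone_alongP mono le_v]].
  split.
    apply/monotone_alongP=> x y; rewrite !inE => /andP[xc xS] /andP[yc yS].
    by rewrite -(set_entry_other T v xc) -(set_entry_other T v yc); apply: mono.
  move=> x; rewrite !inE => /andP[xc xS].
  by rewrite -(set_entry_other T v xc) -[v in leT _ v](set_entry_same T c vM); apply: mono.
apply/monotone_alongP=> x y xS yS rxy.
have xc : x != c by apply: contraTneq rxy => ->; apply: r_max.
rewrite (set_entry_other T v xc); have [yc|yc] := eqVneq y c.
  by rewrite yc set_entry_same // le_v ?inE ?xc // -yc.
by rewrite set_entry_other // mono ?inE ?xc ?yc.
Qed.

Lemma semistandard_set_entry v : 0 < v <= M ->
  semistandard S (set_entry T c v) <->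
  [/\ semistandard (S :\ c) T, {in S :\ c, forall x, left_of x c -> T x <= v}
    & {in S :\ c, forall x, below x c -> T x < v}].
Proof.
case/andP=> v_gt0 vM; have [cS right_end top_end] := cornerSc.
have rowE := monotone_along_set_entry leq vM cS right_end.
have colE := monotone_along_set_entry ltn vM cS top_end.
have suppE : (forall x, (0 < set_entry T c v x) = (x \in S)) <->
             (forall x, (0 < T x) = (x \in S :\ c)).
  split=> supp x; have := supp x; rewrite !inE; have [->|xc] := eqVneq x c;
    by rewrite ?set_entry_same ?set_entry_other ?Tc0 ?v_gt0.
split=> [/semistandardP[/suppE supp /rowE[row row_c] /colE[col col_c]] |].
  by split=> //; apply/semistandardP.
by case=> /semistandardP[supp row col] row_c col_c; apply/semistandardP; split;
  [apply/suppE | apply/rowE | apply/colE].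
Qed.

Lemma reaches_set_entry k i v : v <= M -> i != v ->
  reaches k i (set_entry T c v) = reaches k i T.
Proof.
move=> vM neq_iv; rewrite /reaches; have [//|neq_i0] := eqVneq i 0.
apply: eq_existsb => z; have [->|zc] := eqVneq z c; last by rewrite set_entry_other.
by rewrite set_entry_same // Tc0 !(eq_sym _ i) (negPf neq_iv) (negPf neq_i0).
Qed.

Lemma linked_set_entry_new m : m < M -> (forall x, T x <= m) ->
  linked m.+1 (set_entry T c m.+1) = linked m T && reaches c.2 m T.
Proof.
move=> mM Tm; have reachE k i : i <= m ->
    reaches k i (set_entry T c m.+1) = reaches k i T.
  by move=> im; rewrite reaches_set_entry //; lia.
apply/linkedP/andP => [link | [/linkedP link reach_c] i].
  split; last first.
    have [x] := link m (ltnSn m); have [->|xc] := eqVneq x c; first by rewrite reachE.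
    by rewrite set_entry_other // => Tx; have := Tm x; rewrite Tx ltnn.
  apply/linkedP=> i im; have [x] := link i (ltnW im); rewrite reachE ?(ltnW im) //.
  have [->|xc] := eqVneq x c; last by rewrite set_entry_other //; exists x.
  by rewrite set_entry_same //; lia.
rewrite ltnS leq_eqVlt => /orP[/eqP-> | im].
  by exists c; rewrite ?set_entry_same // reachE.
have [x Tx rx] := link i im; exists x; last by rewrite reachE // ltnW.
by rewrite set_entry_other //; apply: contra_eq_neq Tx => ->; rewrite Tc0.
Qed.

Lemma linked_set_entry_repeat m x0 : m < M -> T x0 = m.+1 :> nat -> x0.2 <= c.2 ->
  linked m.+1 (set_entry T c m.+1) = linked m.+1 T.
Proof.
move=> mM Tx0 x0c; have reachE k i : i <= m ->
    reaches k i (set_entry T c m.+1) = reaches k i T.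
  by move=> im; rewrite reaches_set_entry //; lia.
apply/linkedP/linkedP => link i im; have [x Tx rx] := link i im.
  have [xc|xc] := eqVneq x c; last first.
    by exists x; rewrite -?(set_entry_other T m.+1 xc) // -reachE.
  move: Tx rx; rewrite xc reachE // set_entry_same // => -[<-] rx.
  by exists x0; rewrite ?(reaches_leq x0c).
exists x; last by rewrite reachE.
by rewrite set_entry_other //; apply: contra_eq_neq Tx => ->; rewrite Tc0.
Qed.

Lemma qyt_set_entry_new m : m < M -> (forall x, T x <= m) ->
  qyt S m.+1 (set_entry T c m.+1) && rightmost c m.+1 (set_entry T c m.+1) =
  qyt (S :\ c) m T && reaches c.2 m T.
Proof.
move=> mM Tm; have m1_bounds : 0 < m.+1 <= M by rewrite mM.
apply/andP/andP => [[/qytP[/(semistandard_set_entry m1_bounds)[sT _ _] _]] |].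
  by rewrite linked_set_entry_new // => /andP[lT rT] _; split=> //; apply/qytP.
case=> /qytP[sT _ lT] rT; split.
  apply/qytP; split; last by rewrite linked_set_entry_new // lT.
  - by apply/(semistandard_set_entry m1_bounds); split=> // x _ _; rewrite ?ltnS ?leqW.
  - move=> x; have [->|xc] := eqVneq x c; first by rewrite set_entry_same.
    by rewrite set_entry_other // leqW.
apply/rightmostP; split=> [|x]; first by rewrite set_entry_same.
by move=> /[swap] xc; rewrite set_entry_other // => Tx; have := Tm x; rewrite Tx ltnn.
Qed.

Lemma qyt_set_entry_repeat m x0 : m < M -> m < T x0 ->
  qyt S m.+1 (set_entry T c m.+1) && rightmost c m.+1 (set_entry T c m.+1) =
  qyt (S :\ c) m.+1 T && ~~ reaches c.2 m.+1 T.
Proof.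
move=> mM Tx0; have m1_bounds : 0 < m.+1 <= M by rewrite mM.
have x0c : x0 != c by apply: contraTneq Tx0 => ->; rewrite Tc0.
have Tx0_max : T x0 <= m.+1 -> T x0 = m.+1 :> nat by lia.
have left_of_c : (forall x, T x = m.+1 :> nat -> x.2 < c.2) <-> ~~ reaches c.2 m.+1 T.
  split=> [left|/reachesP nreach x Tx].
    by apply/reachesP=> -[//|[z /left]]; rewrite ltnNge => /negP.
  by rewrite ltnNge; apply/negP => cx; apply: nreach; right; exists x.
apply/andP/andP => [[/qytP[/(semistandard_set_entry m1_bounds)[sT _ _] Tm lT]] |].
  have {}Tx0_max : T x0 = m.+1 :> nat by apply: Tx0_max; rewrite -(set_entry_other T m.+1 x0c).
  case/rightmostP=> _ right; have left x : T x = m.+1 :> nat -> x.2 < c.2.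
    move=> Tx; have xc : x != c by apply: contra_eq_neq Tx => ->; rewrite Tc0.
    by apply: right; rewrite ?set_entry_other.
  split; last exact/left_of_c.
  apply/qytP; split=> // [x|]; last by rewrite -(linked_set_entry_repeat mM Tx0_max) // ltnW ?left.
  have [->|xc] := eqVneq x c; first by rewrite Tc0.
  by rewrite -(set_entry_other T m.+1 xc).
case=> /qytP[sT Tm lT] /left_of_c left; have {}Tx0_max := Tx0_max (Tm x0).
split; last first.
  apply/rightmostP; split=> [|x]; first by rewrite set_entry_same.
  by move=> /[swap] xc; rewrite set_entry_other //; apply: left.
apply/qytP; split; last by rewrite (linked_set_entry_repeat mM Tx0_max) // ltnW ?left.
- apply/(semistandard_set_entry m1_bounds); split=> // x _ /andP[/eqP same_col _].
  by rewrite ltn_neqAle Tm andbT; apply/eqP => /left; rewrite same_col ltnn.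
- move=> x; have [->|xc] := eqVneq x c; first by rewrite set_entry_same.
  by rewrite set_entry_other.
Qed.

Lemma qyt_set_entry m : m < M ->
  qyt S m.+1 (set_entry T c m.+1) && rightmost c m.+1 (set_entry T c m.+1) =
  qyt (S :\ c) m T && reaches c.2 m T || qyt (S :\ c) m.+1 T && ~~ reaches c.2 m.+1 T.
Proof.
move=> mM; have [/forallP Tm|] := boolP [forall x, T x <= m].
  rewrite qyt_set_entry_new // orbC; suff /negPf-> : ~~ qyt (S :\ c) m.+1 T by [].
  by apply/negP => /qyt_max_occurs[//|x Tx]; have := Tm x; rewrite Tx ltnn.
rewrite negb_forall => /existsP[x0]; rewrite -ltnNge => Tx0.
rewrite (qyt_set_entry_repeat mM Tx0); suff /negPf-> : ~~ qyt (S :\ c) m T by [].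
by apply/qytP=> -[_ /(_ x0)]; rewrite leqNgt Tx0.
Qed.

End Insertion.

Lemma card_qyt_at S c m : m < M -> corner S c ->
  #|[set T | qyt S m.+1 T && rightmost c m.+1 T]| =
  #|[set T | qyt (S :\ c) m T && reaches c.2 m T]| +
  #|[set T | qyt (S :\ c) m.+1 T && ~~ reaches c.2 m.+1 T]|.
Proof.
move=> mM cornerSc; set new := [set T | _ && reaches _ _ _]; set rep := [set T | _ && ~~ _].
have empty_c T n : qyt (S :\ c) n T -> T c = 0 :> nat.
  by move=> qT; apply/eqP; rewrite -leqn0 leqNgt (qyt_support c qT) !inE eqxx.
have Tc0 T : T \in new :|: rep -> T c = 0 :> nat.
  by rewrite !inE => /orP[] /andP[/empty_c].
have disjoint : new :&: rep = set0.
  apply/setP=> T; rewrite !inE; apply/negP => /andP[/andP[/qytP[_ Tm _] _] /andP[]].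
  by case/qyt_max_occurs=> // x Tx _; have := Tm x; rewrite Tx ltnn.
rewrite -cardsUI disjoint cards0 addn0.
rewrite -[RHS](card_in_imset (f := fun T => set_entry T c m.+1)); last first.
  move=> T T' /Tc0 Tc /Tc0 T'c /(congr1 (fun T => set_entry T c 0)).
  by rewrite !set_entryK.
congr #|pred_of_set _|; apply/setP=> T; apply/idP/imsetP => [|[T' T'in ->]]; last first.
  by move: T'in (Tc0 _ T'in); rewrite !inE => ? ?; rewrite qyt_set_entry.
rewrite inE => qT; exists (set_entry T c 0); last first.
  by rewrite set_entryK //; case/andP: qT => _ /rightmostP[].
rewrite !inE -(qyt_set_entry cornerSc) ?set_entry_same // set_entryK //.
by case/andP: qT => _ /rightmostP[].
Qed.

End Tableaux.

Lemma linked_leftmost (R C M m : nat) (T : {ffun 'I_R * 'I_C -> 'I_M.+1}) : 0 < m ->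
  linked m T <->
  (exists x, T x = m :> nat) /\
  forall i, 1 < i <= m -> (exists x, T x = i :> nat) ->
    exists x z, [/\ T x = i :> nat, forall y, T y = i :> nat -> x.2 <= y.2,
                    T z = i.-1 :> nat & x.2 <= z.2].
Proof.
move=> m_gt0; split=> [/linkedP link | [occurs_m leftmost]].
  split; first by have [|x Tx _] := link m.-1; [rewrite prednK | exists x; rewrite Tx prednK].
  move=> i /andP[i_gt1 im] _; have [|x0 Tx0 /reachesP[|[z Tz x0z]]] := link i.-1; try lia.
  have {}Tx0 : T x0 == i :> nat by rewrite Tx0; lia.
  have [x /eqP Tx xmin] := @arg_minnP _ x0 (fun x => T x == i :> nat) (fun x => x.2) Tx0.
  exists x, z; split=> // [y /eqP/xmin//|]; exact: leq_trans (xmin _ Tx0) x0z.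
have occurs k : k < m -> exists x, T x = m - k :> nat.
  elim: k => [|k IH] km; first by rewrite subn0.
  have [|_ [z [_ _ Tz _]]] := leftmost (m - k) _ (IH (ltnW km)); first by lia.
  by exists z; rewrite Tz subnS.
apply/linkedP=> -[|i] im.
  by have [|x Tx] := occurs m.-1; [lia | exists x; [rewrite Tx; lia | apply/reachesP; left]].
have [|x0 Tx0] := occurs (m - i.+2); first by lia.
rewrite subKn // in Tx0.
have [|x [z [Tx _ Tz xz]]] := leftmost i.+2 im; first by exists x0.
by exists x => //; apply/reachesP; right; exists z.
Qed.

Section QuasiYamanouchi.
Variables (lam : seq nat) (m : nat) (T : filling lam m).

Lemma semistandard_insE :
  semistandard [set x | ins x] T =
  [&& [forall x, ~~ ins x ==> (nat_of_ord (T x) == 0)],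
      [forall x, ins x ==> (0 < T x)],
      [forall x, forall y, [&& ins x, ins y, x.1 == y.1 & x.2 < y.2] ==> (T x <= T y)] &
      [forall x, forall y, [&& ins x, ins y, x.2 == y.2 & x.1 < y.1] ==> (T x < T y)]].
Proof.
apply/semistandardP/and4P => [[supp /monotone_alongP row /monotone_alongP col] | []].
  have {}supp x : ins x = (0 < T x) by rewrite supp inE.
  split; apply/forallP=> x.
  - by rewrite supp -eqn0Ngt implybb.
  - by rewrite supp implybb.
  - by apply/forallP=> y; apply/implyP=> /and3P[xS yS]; apply: row; rewrite inE.
  - by apply/forallP=> y; apply/implyP=> /and3P[xS yS]; apply: col; rewrite inE.
move=> /forallP out /forallP pos /forallP row /forallP col; split.
- move=> x; rewrite inE; have := out x; have := pos x.
  by case: ins => //= _; rewrite lt0n => ->.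
- apply/monotone_alongP=> x y; rewrite !inE => xS yS xy.
  by have /forallP/(_ y)/implyP := row x; rewrite xS yS; apply.
- apply/monotone_alongP=> x y; rewrite !inE => xS yS xy.
  by have /forallP/(_ y)/implyP := col x; rewrite xS yS; apply.
Qed.

Lemma is_QYT_eqE : 0 < m -> is_QYT_eq T = qyt [set x | ins x] m T.
Proof.
move=> m_gt0; have Tm : [forall x, T x <= m] by apply/forallP=> x; rewrite -ltnS.
rewrite /qyt Tm semistandard_insE /is_QYT_eq -!andbA /=.
apply: andb_id2l => /forallP out; apply: andb_id2l => /forallP pos.
do 2!apply: andb_id2l => _.
have supp x : ins x = (0 < T x).
  by have := out x; have := pos x; case: ins => //= _; rewrite lt0n => ->.
have entryE x (i : 'I_m.+1) : (T x == i) = (T x == i :> nat) by [].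
apply/andP/idP => [[/existsP[x0 /andP[_ /eqP Tx0]] /forallP yam] |].
  apply/(linked_leftmost _ m_gt0); split; first by exists x0.
  move=> i /andP[i_gt1 im] [x1 Tx1]; have := yam (T x1); rewrite Tx1 i_gt1 /=.
  have -> : [exists x, ins x && (T x == T x1)].
    by apply/existsP; exists x1; rewrite supp Tx1 eqxx (ltnW i_gt1).
  case/existsP=> x /and4P[_ /eqP Tx /forallP xmin /existsP[z /and3P[_ /eqP Tz xz]]].
  exists x, z; rewrite Tx; split=> // y Ty; have /implyP := xmin y; apply.
  by rewrite supp Ty (ltnW i_gt1) entryE Ty Tx1 /=.
case/(linked_leftmost _ m_gt0)=> -[x0 Tx0] leftmost; split.
  by apply/existsP; exists x0; rewrite supp Tx0 m_gt0 eqxx.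
apply/forallP=> i; apply/implyP=> /andP[i_gt1 /existsP[x1 /andP[_ /eqP Tx1]]].
have [||x [z [Tx xmin Tz xz]]] := leftmost i; first by rewrite i_gt1 -ltnS ltn_ord.
  by exists x1; rewrite Tx1.
apply/existsP; exists x; rewrite supp entryE Tx (ltnW i_gt1) eqxx /=; apply/andP; split.
  by apply/forallP=> y; apply/implyP=> /andP[_ /eqP Ty]; apply: xmin; rewrite Ty.
by apply/existsP; exists z; rewrite supp Tz eqxx xz -subn1 subn_gt0 i_gt1.
Qed.

End QuasiYamanouchi.

Local Open Scope ring_scope.

(** * Recurrences for the numbers of tableaux *)

Section Counting.
Variables R C M : nat.
Local Notation cell := ('I_R * 'I_C)%type.
Local Notation tableau := {ffun cell -> 'I_M.+1}.
Implicit Types (S : {set cell}) (T : tableau) (a b c x : cell) (k : nat) (m : int).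

(* Counts are extended by [0] to [m < 0], so that recurrences hold without boundary cases. *)
Definition nqyt_with (p : nat -> pred tableau) S (m : int) : rat :=
  if m is Posz n then #|[set T : tableau | qyt S n T && p n T]|%:R else 0.

Definition nqyt S : int -> rat := nqyt_with (fun _ => predT) S.
Definition nqyt_at S c : int -> rat := nqyt_with (rightmost c) S.
Definition nqyt_reach S k : int -> rat := nqyt_with (reaches k) S.

Lemma nqytE S (n : nat) : nqyt S n = #|[set T : tableau | qyt S n T]|%:R.
Proof. by congr _%:R; apply: eq_card => T; rewrite !inE andbT. Qed.

Lemma nqyt_with0 p S : S != set0 -> nqyt_with p S 0 = 0.
Proof.
move=> /eqP S0; rewrite /nqyt_with /= eq_card0 // => T; rewrite inE.
by apply/negP => /andP[/qyt0_eq_set0].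
Qed.

Lemma nqyt_reach_col0 S m : nqyt_reach S 0 m = nqyt S m.
Proof.
case: m => // m; congr _%:R; apply: eq_card => T; rewrite !inE andbT.
apply/andb_idr => qT; apply/reachesP; case: m qT => [|m] qT; [by left | right].
by have [//|x Tx] := qyt_max_occurs qT; exists x.
Qed.

Lemma nqyt_at_erase S c m : m <= M -> corner S c ->
  nqyt_at S c m =
  nqyt_reach (S :\ c) c.2 (m - 1) + nqyt (S :\ c) m - nqyt_reach (S :\ c) c.2 m.
Proof.
move=> + cornerSc; case: m => [[|m]|m] // mM.
- rewrite [LHS]nqyt_with0 ?(corner_neq0 cornerSc) //.
  by have -> : nqyt_reach (S :\ c) c.2 0%N = nqyt (S :\ c) 0%N by []; rewrite addrK.
- have -> : m.+1%:Z - 1 = m by lia.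
  have split_card : (#|[set T : tableau | qyt (S :\ c) m.+1 T]| =
      #|[set T : tableau | qyt (S :\ c) m.+1 T && reaches c.2 m.+1 T]| +
      #|[set T : tableau | qyt (S :\ c) m.+1 T && ~~ reaches c.2 m.+1 T]|)%N.
    rewrite -(cardsID [set T : tableau | reaches c.2 m.+1 T]).
    by congr (_ + _)%N; apply: eq_card => T; rewrite !inE // andbC.
  by rewrite nqytE split_card /nqyt_at /nqyt_reach /= card_qyt_at // !natrD addrA addrAC addrK.
Qed.

Lemma nqyt_at_corner S c m : S != set0 -> nqyt_at S c m != 0 -> corner S c.
Proof.
move=> S0; case: m => [[|m]|m]; rewrite /nqyt_at ?nqyt_with0 ?eqxx //=.
rewrite pnatr_eq0 -lt0n => /card_gt0P[T]; rewrite inE => /andP[qT rT].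
exact: rightmost_corner qT rT _.
Qed.

Lemma nqyt_at_eq0 S c x m : x \in S -> left_of c x || below c x -> nqyt_at S c m = 0.
Proof.
move=> xS c_x; have S0 : S != set0 by apply/set0Pn; exists x.
apply/eqP; apply: contraTT c_x => /(nqyt_at_corner S0)[_ /(_ x xS) + /(_ x xS)].
by rewrite negb_or => -> ->.
Qed.

Lemma nqyt_reach_sum S k m : S != set0 ->
  nqyt_reach S k m = \sum_(c : cell | (k <= c.2)%N) nqyt_at S c m.
Proof.
move=> S0; case: m => [[|m]|m]; last by rewrite big1.
  by rewrite /nqyt_at big1 => [|c _]; rewrite [LHS]nqyt_with0.
rewrite /nqyt_reach /nqyt_at /= -natr_sum; congr _%:R.
rewrite -sum1_card; under [RHS]eq_bigr do rewrite -sum1_card.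
rewrite (exchange_big_dep [in [set T : tableau | qyt S m.+1 T && reaches k m.+1 T]]) /=.
  apply: eq_bigr => T; rewrite inE => /andP[qT rT].
  have [//|c rc] := rightmost_exists qT.
  rewrite (big_pred1 c) // => c'; rewrite !inE qT /=; apply/andP/eqP => [[_ rc'] | ->].
    exact: rightmost_unique rc' rc.
  by rewrite -(reaches_rightmost _ _ rc).
by move=> c T kc; rewrite !inE => /andP[-> rc]; rewrite (reaches_rightmost _ _ rc).
Qed.

Lemma nqyt_reach_corners S k (s : seq cell) m : S != set0 -> uniq s ->
  (forall c, c \in s -> (k <= c.2)%N) -> (forall c, corner S c -> (k <= c.2)%N -> c \in s) ->
  nqyt_reach S k m = \sum_(c <- s) nqyt_at S c m.
Proof.
move=> S0 uniq_s sk corner_s; rewrite nqyt_reach_sum // big_uniq // big_mkcond [RHS]big_mkcond.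
apply: eq_bigr => c _; have [/sk->//|cs] := boolP (c \in s); case: ifP => // kc.
by apply/eqP; apply: contraNT cs => /(nqyt_at_corner S0)/corner_s; apply.
Qed.

Lemma nqyt_corners S (s : seq cell) m : S != set0 -> uniq s ->
  (forall c, corner S c -> c \in s) -> nqyt S m = \sum_(c <- s) nqyt_at S c m.
Proof.
by move=> S0 us corner_s; rewrite -nqyt_reach_col0; apply: nqyt_reach_corners => // c /corner_s.
Qed.

Lemma nqyt_reach_succ S b m : corner S b ->
  nqyt_reach S b.2 m = nqyt_at S b m + nqyt_reach S b.2.+1 m.
Proof.
move=> cornerSb; have S0 := corner_neq0 cornerSb.
rewrite !nqyt_reach_sum // (bigD1 b) //=; congr (_ + _).
rewrite big_mkcond [RHS]big_mkcond; apply: eq_bigr => c _.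
have [->|neq_cb] := eqVneq c b; first by rewrite andbF ltnn.
rewrite andbT; have [//|//|/val_inj same_col] := ltngtP b.2 c.2.
apply/eqP; apply: contraNT neq_cb => /(nqyt_at_corner S0) cornerSc.
by rewrite (corner_col_inj cornerSb cornerSc).
Qed.

Lemma nqyt_at_last_col S c m : m <= M -> corner S c -> S :\ c != set0 ->
  {in S :\ c, forall x, (x.2 < c.2)%N} -> nqyt_at S c m = nqyt (S :\ c) m.
Proof.
move=> mM cornerSc S'0 left; have reach0 (n : int) : nqyt_reach (S :\ c) c.2 n = 0.
  rewrite (nqyt_reach_corners (s := [::])) ?big_nil // => c' [/left].
  by rewrite ltnNge => /negP.
by rewrite nqyt_at_erase // !reach0 add0r subr0.
Qed.

Lemma nqyt_at_first_col S c m : m <= M -> corner S c -> c.2 = 0%N :> nat ->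
  nqyt_at S c m = nqyt (S :\ c) (m - 1).
Proof.
by move=> mM cornerSc c0; rewrite nqyt_at_erase // c0 !nqyt_reach_col0 addrK.
Qed.

Lemma nqyt_at_next_to_last_col S c a m : m <= M -> corner S c -> corner (S :\ c) a ->
  (c.2 <= a.2)%N -> {in S :\ c, forall x, (c.2 <= x.2)%N -> x.1 = a.1 :> nat} ->
  S :\ c :\ a != set0 -> {in S :\ c :\ a, forall x, (x.2 < a.2)%N} ->
  nqyt_at S c m = nqyt (S :\ c :\ a) (m - 1) + nqyt (S :\ c) m - nqyt (S :\ c :\ a) m.
Proof.
move=> mM cornerSc cornera ca row_a S''0 left.
have reach_a (n : int) : n <= M -> nqyt_reach (S :\ c) c.2 n = nqyt (S :\ c :\ a) n.
  move=> nM; rewrite -nqyt_at_last_col //.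
  rewrite (nqyt_reach_corners (s := [:: a])) ?big_seq1 ?(corner_neq0 cornera) //.
    by move=> x; rewrite inE => /eqP->.
  move=> x [xS' right_x _] cx; rewrite inE; apply: contraT => neq_xa.
  have [aS' _ _] := cornera; have := right_x a aS'.
  by rewrite /left_of (row_a x xS' cx) eqxx left // !inE neq_xa -in_setD1.
by rewrite nqyt_at_erase // !reach_a //; lia.
Qed.

Lemma nqyt_at_second_col S c b m : m <= M -> corner S c -> corner (S :\ c) b ->
  c.2 = 1%N :> nat -> b.2 = 0%N :> nat ->
  nqyt_at S c m =
  nqyt (S :\ c) (m - 1) - nqyt (S :\ c :\ b) (m - 1 - 1) + nqyt (S :\ c :\ b) (m - 1).
Proof.
move=> mM cornerSc cornerb c1 b0.
have reach1 (n : int) : n <= M ->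
    nqyt_reach (S :\ c) 1 n = nqyt (S :\ c) n - nqyt (S :\ c :\ b) (n - 1).
  move=> nM; have := nqyt_reach_succ n cornerb.
  by rewrite b0 nqyt_reach_col0 nqyt_at_first_col // => ->; rewrite addrC addKr.
by rewrite nqyt_at_erase // c1 !reach1 //; [ring | lia].
Qed.

Lemma nqyt_set0 m : nqyt set0 m = (m == 0)%:R.
Proof.
case: m => [m|//]; rewrite nqytE; congr _%:R; case: m => [|m].
  rewrite (_ : [set _ | _] = [set [ffun=> ord0]]) ?cards1 //.
  apply/setP=> T; rewrite !inE; apply/qytP/eqP => [[_ T0 _]|->].
    by apply/ffunP=> x; apply/val_inj/eqP; rewrite ffunE /= -leqn0.
  split; [apply/semistandardP; split | |].
  - by move=> x; rewrite ffunE inE.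
  - by apply/monotone_alongP=> x y; rewrite inE.
  - by apply/monotone_alongP=> x y; rewrite inE.
  - by move=> x; rewrite ffunE.
  - by apply/linkedP=> i; rewrite ltn0.
apply: eq_card0 => T; rewrite inE; apply/negP => qT.
have [//|x Tx] := qyt_max_occurs qT.
by have := qyt_support x qT; rewrite Tx inE.
Qed.

End Counting.

(** * Solutions of the recurrences *)

(* Junk value: [facz x] is [`|x|!] at negative [x]. *)
Definition facz (x : int) : rat := (`|x|%N)`!%:R.

(* [1 / x!], extended by [0] to [x < 0] like the reciprocal Gamma function. *)
Definition invfz (x : int) : rat := if 0 <= x then (facz x)^-1 else 0.

Lemma facz_neq0 (x : int) : facz x != 0.
Proof. by rewrite pnatr_eq0 -lt0n fact_gt0. Qed.

Lemma facz_pred (x : int) : 0 < x -> facz x = x%:~R * facz (x - 1).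
Proof.
case: x => // -[//|n] _; have -> : n.+1%:Z - 1 = n by lia.
by rewrite /facz factS natrM.
Qed.

Lemma facz_invfz (x : int) : 0 <= x -> facz x * invfz x = 1.
Proof. by rewrite /invfz => ->; rewrite divff // facz_neq0. Qed.

Lemma invfz_neg (x : int) : x < 0 -> invfz x = 0.
Proof. by rewrite /invfz leNgt => ->. Qed.

Lemma invfz_pred (x : int) : invfz (x - 1) = x%:~R * invfz x.
Proof.
have [x_lt0|x_gt0|->] := ltgtP x 0; last by rewrite mul0r.
  by rewrite !invfz_neg ?mulr0 //; lia.
have x1_ge0 : 0 <= x - 1 by lia.
rewrite /invfz x1_ge0 ltW // (facz_pred x_gt0) invfM mulVKf // intr_eq0; lia.
Qed.

Definition hook_count (a b m : int) : rat :=
  facz (a + b) * invfz a * invfz b * (m == b + 1)%:R.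

Lemma hook_count_rec (a b m : int) : 0 < a + b ->
  hook_count a b m = hook_count (a - 1) b m + hook_count a (b - 1) (m - 1).
Proof.
move=> ab_gt0; rewrite /hook_count.
have -> : (m - 1 == b - 1 + 1) = (m == b + 1) by lia.
have -> : a - 1 + b = a + b - 1 by ring.
rewrite (addrA a) !invfz_pred (facz_pred ab_gt0); ring.
Qed.

(* With Frobenius coordinates [(a1, a2 | b1, b2)], [d] and [e] are the numbers of descents and
   ascents of a standardization, so that [d + e + 1] is the number of cells. *)
Definition frob_count (a1 a2 b1 b2 d e : int) : rat :=
  (a1 - a2)%:~R * (b1 - b2)%:~R *
  (facz (a1 + b1) * facz (a1 + b2) * facz (a2 + b1) * facz (a2 + b2)) *
  (invfz a1 * invfz a2 * invfz b1 * invfz b2) *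
  (invfz (d - b1) * invfz (d - b2) * invfz (e - a1) * invfz (e - a2)).

Lemma frob_count_eq0 (a1 a2 b1 b2 d e : int) :
  [|| a1 == a2, b1 == b2, a2 < 0 | b2 < 0] -> frob_count a1 a2 b1 b2 d e = 0.
Proof.
by rewrite /frob_count => /or4P[/eqP-> | /eqP-> | /invfz_neg-> | /invfz_neg->];
  rewrite !(subrr, mulr0z, mulr0, mul0r).
Qed.

Lemma frob_count_rec (a1 a2 b1 b2 d e : int) :
  0 < a1 + b1 -> 0 < a1 + b2 -> 0 < a2 + b1 -> 0 < a2 + b2 ->
  d + e = a1 + a2 + b1 + b2 + 1 ->
  frob_count a1 a2 b1 b2 d e =
    frob_count (a1 - 1) a2 b1 b2 d (e - 1) + frob_count a1 a2 (b1 - 1) b2 (d - 1) e +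
    (frob_count a1 a2 b1 (b2 - 1) (d - 1) e
     - frob_count a1 a2 (b1 - 1) (b2 - 1) (d - 1 - 1) e
     + frob_count a1 a2 (b1 - 1) (b2 - 1) (d - 1) (e - 1)) +
    (frob_count (a1 - 1) (a2 - 1) b1 b2 (d - 1) (e - 1)
     + frob_count a1 (a2 - 1) b1 b2 d (e - 1)
     - frob_count (a1 - 1) (a2 - 1) b1 b2 d (e - 1 - 1)).
Proof.
move=> a1b1 a1b2 a2b1 a2b2 de; rewrite /frob_count.
have predD x y : x - 1 + y = x + y - 1 :> int by ring.
have Dpred x y : x + (y - 1) = x + y - 1 :> int by ring.
have predBpred x y : x - 1 - (y - 1) = x - y :> int by ring.
have predB x y : x - 1 - y = x - y - 1 :> int by ring.
rewrite !predBpred !predB !predD !Dpred !invfz_pred.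
rewrite (facz_pred a1b1) (facz_pred a1b2) (facz_pred a2b1) (facz_pred a2b2).
have -> : (e - a1)%:~R = (a2 + b1 + b2 + 1 - d)%:~R :> rat by congr _%:~R; lia.
have -> : (e - a2)%:~R = (a1 + b1 + b2 + 1 - d)%:~R :> rat by congr _%:~R; lia.
ring.
Qed.

Lemma frob_count_inner (a b d e : int) : 0 <= a -> 0 <= b ->
  frob_count a 0 b 0 d e =
  (a * b)%:~R * facz (a + b) * (invfz (d - b) * invfz (e - a)) * (invfz d * invfz e).
Proof.
move=> a_ge0 b_ge0; rewrite /frob_count !subr0 ?addr0 !add0r.
have [-> ->] : facz 0 = 1 /\ invfz 0 = 1 by [].
transitivity ((a * b)%:~R * facz (a + b) * (facz a * invfz a) * (facz b * invfz b) *
    (invfz (d - b) * invfz (e - a)) * (invfz d * invfz e) : rat); first by ring.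
by rewrite !facz_invfz // !mulr1.
Qed.

Lemma invfz_mul_compl (x y : int) : x + y = 1 ->
  invfz x * invfz y = (x == 0)%:R + (x == 1)%:R.
Proof.
move=> xy1; have [x_lt0|[x_gt1|[x0|x1]]] : x < 0 \/ 1 < x \/ x = 0 \/ x = 1 by lia.
- have [-> ->] : (x == 0) = false /\ (x == 1) = false by lia.
  by rewrite invfz_neg // mul0r.
- have [-> ->] : (x == 0) = false /\ (x == 1) = false by lia.
  by rewrite mulrC invfz_neg ?mul0r //; lia.
- by rewrite x0 (_ : y = 1) //; lia.
- by rewrite x1 (_ : y = 0) //; lia.
Qed.

Lemma frob_count_inner_rec (a b d e : int) : 0 < a -> 0 < b -> d + e = a + b + 1 ->
  frob_count a 0 b 0 d e =
    frob_count (a - 1) 0 b 0 d (e - 1) + frob_count a 0 (b - 1) 0 (d - 1) e +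
    (hook_count a b d - hook_count a (b - 1) (d - 1) + hook_count a (b - 1) d).
Proof.
move=> a_gt0 b_gt0 de; have ab_gt0 : 0 < a + b by lia.
rewrite hook_count_rec // addrK !frob_count_inner; try lia.
have predBpred x y : x - 1 - (y - 1) = x - y :> int by ring.
rewrite !predBpred invfz_mul_compl; last by lia.
rewrite /hook_count subrK (addrAC a) !(addrA a) (facz_pred ab_gt0) !invfz_pred.
rewrite subr_eq0 subr_eq (addrC 1).
have [d_b|_] := eqVneq d b.
  have -> : e = a + 1 by lia.
  have invfz_a : invfz a = (a + 1)%:~R * invfz (a + 1) by rewrite -invfz_pred addrK.
  by rewrite d_b (_ : (b == b + 1) = false) /= ?invfz_a; [ring | lia].
have [d_b|_] := eqVneq d (b + 1); last by rewrite /=; ring.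
have -> : e = a by lia.
have invfz_b : invfz b = (b + 1)%:~R * invfz (b + 1) by rewrite -invfz_pred addrK.
by rewrite d_b invfz_b /=; ring.
Qed.

Lemma natr_bin (F : numFieldType) (n k : nat) : (k <= n)%N ->
  'C(n, k)%:R = n`!%:R / (k`!%:R * (n - k)`!%:R) :> F.
Proof.
by move=> kn; rewrite -(bin_fact kn) !natrM mulfK // mulf_neq0 // pnatr_eq0 -lt0n fact_gt0.
Qed.

Lemma frob_count_binomial (a1 a2 b1 b2 d e : nat) :
  (a2 <= a1)%N -> (b2 < b1)%N -> (b1 <= d)%N -> (a1 <= e)%N ->
  (d + e = a1 + a2 + b1 + b2 + 1)%N ->
  frob_count a1 a2 b1 b2 d e =
    (a1 - a2)%:R / (d - b2)%:R * 'C(a1 + b1, d - b2.+1)%:R *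
    'C(a2 + b1, d - b2.+1)%:R * 'C(d - b2.+1, d - b1)%:R *
    'C(a2 + b2, b2)%:R * 'C(a1 + b2, b2)%:R / 'C(b1, b2)%:R.
Proof.
move=> a21 b21 b1d a1e de; have fact_neq0 n : n`!%:R != 0 :> rat := facz_neq0 n.
have invfz_nat n : invfz n%:Z = (n`!%:R)^-1 by [].
have facz_nat n : facz n%:Z = n`!%:R by [].
rewrite /frob_count !natr_bin; try lia.
rewrite !subzn; try lia.
rewrite !addnK !invfz_nat !facz_nat -!pmulrn.
have -> : (d - b2.+1 - (d - b1) = b1 - b2.+1)%N by lia.
have -> : (a1 + b1 - (d - b2.+1) = e - a2)%N by lia.
have -> : (a2 + b1 - (d - b2.+1) = e - a1)%N by lia.
have -> : (b1 - b2 = (b1 - b2.+1).+1)%N by lia.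
have -> : (d - b2 = (d - b2.+1).+1)%N by lia.
rewrite !factS !natrM; field.
by rewrite !fact_neq0 !nat1r !pnatr_eq0.
Qed.

(** * Diagrams of Durfee size at most two *)

Section Diagrams.
Variables R C : nat.
Local Notation cell := ('I_R.+1 * 'I_C.+1)%type.
Implicit Types i j : int.

(* The diagram with Frobenius coordinates [(a1, a2 | b1, b2)]; [a2 = b2 = -1] gives a hook. *)
Definition frobenius_diagram (a1 a2 b1 b2 : int) : {set cell} :=
  [set x : cell | [|| (x.1 == 0%N :> nat) && (x.2%:Z <= a1),
                      (x.2 == 0%N :> nat) && (x.1%:Z <= b1),
                      (x.1 == 1%N :> nat) && (1 <= x.2%:Z <= a2 + 1)
                    | (x.2 == 1%N :> nat) && (1 <= x.1%:Z <= b2 + 1)]].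

Definition hook (a b : int) : {set cell} := frobenius_diagram a (-1) b (-1).

Definition cell_at i j : cell := (inord `|i|, inord `|j|).

Lemma cell_at_row i j : 0 <= i <= R -> (cell_at i j).1 = i :> int.
Proof. by move=> iR; rewrite inordK; lia. Qed.

Lemma cell_at_col i j : 0 <= j <= C -> (cell_at i j).2 = j :> int.
Proof. by move=> jC; rewrite inordK; lia. Qed.

End Diagrams.

Arguments cell_at : simpl never.

(* The coordinates of named cells reach [lia] through the [Let] facts of the sections below. *)
Ltac cell_lia := rewrite ?inE /left_of /below ?cell_eqE; lia.
Ltac corner_lia := split; [cell_lia | move=> x; cell_lia | move=> x; cell_lia].

Section Hook.
Variables (R C M : nat) (a b : int).
Hypotheses (a_bounds : 0 <= a <= C) (b_bounds : 0 <= b <= R).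
Local Notation shape := (hook R C a b).
Local Notation arm := (cell_at R C 0 a).
Local Notation leg := (cell_at R C b 0).

Let arm_row : arm.1 = 0 :> int. Proof. by rewrite cell_at_row. Qed.
Let arm_col : arm.2 = a :> int. Proof. by rewrite cell_at_col. Qed.
Let leg_row : leg.1 = b :> int. Proof. by rewrite cell_at_row. Qed.
Let leg_col : leg.2 = 0 :> int. Proof. by rewrite cell_at_col. Qed.

Lemma hook_neq0 : shape != set0.
Proof. by apply/set0Pn; exists arm; cell_lia. Qed.

Lemma hook_corner c : corner shape c -> c \in [:: arm; leg].
Proof.
have [arm_in leg_in] : arm \in shape /\ leg \in shape by split; cell_lia.
by case=> + /(_ arm arm_in) + /(_ leg leg_in); cell_lia.
Qed.

Lemma nqyt_at_hook_arm (m : int) : m <= M -> 0 < a + b ->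
  nqyt_at M shape arm m = if 0 < a then nqyt M (hook R C (a - 1) b) m else 0.
Proof.
move=> mM ab_gt0; case: ifP => a_gt0; last by apply: (@nqyt_at_eq0 _ _ _ _ _ leg); cell_lia.
have erase : shape :\ arm = hook R C (a - 1) b by apply/setP=> x; cell_lia.
rewrite nqyt_at_last_col ?erase //; first by corner_lia.
  by apply/set0Pn; exists leg; cell_lia.
by move=> x; cell_lia.
Qed.

Lemma nqyt_at_hook_leg (m : int) : m <= M -> 0 < a + b ->
  nqyt_at M shape leg m = if 0 < b then nqyt M (hook R C a (b - 1)) (m - 1) else 0.
Proof.
move=> mM ab_gt0; case: ifP => b_gt0; last by apply: (@nqyt_at_eq0 _ _ _ _ _ arm); cell_lia.
have erase : shape :\ leg = hook R C a (b - 1) by apply/setP=> x; cell_lia.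
by rewrite nqyt_at_first_col ?erase //; [corner_lia | lia].
Qed.

Lemma nqyt_hook_box (m : int) : m <= M -> a = 0 -> b = 0 -> nqyt M shape m = (m == 1)%:R.
Proof.
move=> mM a_eq0 b_eq0; have erase : shape :\ arm = set0 by apply/setP=> x; cell_lia.
rewrite (nqyt_corners _ (s := [:: arm]) _ hook_neq0) ?big_seq1 //; last first.
  by move=> c /hook_corner; cell_lia.
by rewrite nqyt_at_first_col ?erase ?nqyt_set0 ?subr_eq0 //; [corner_lia | lia].
Qed.

Lemma nqyt_hook_rec (m : int) : m <= M -> 0 < a + b ->
  nqyt M shape m = (if 0 < a then nqyt M (hook R C (a - 1) b) m else 0) +
                   (if 0 < b then nqyt M (hook R C a (b - 1)) (m - 1) else 0).
Proof.
move=> mM ab_gt0; rewrite -nqyt_at_hook_arm // -nqyt_at_hook_leg //.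
rewrite (nqyt_corners _ (s := [:: arm; leg]) _ hook_neq0).
- by rewrite big_cons big_seq1.
- by rewrite cons_uniq andbT; cell_lia.
- exact: hook_corner.
Qed.

End Hook.

Lemma nqyt_hook (R C M : nat) (a b m : int) : 0 <= a <= C -> 0 <= b <= R -> m <= M ->
  nqyt M (hook R C a b) m = hook_count a b m.
Proof.
have [n] := ubnP (absz (a + b)); elim: n a b m => // n IH a b m abn aC bR mM.
have [ab_gt0|ab_le0] := ltP 0 (a + b); last first.
  have [a_eq0 b_eq0] : a = 0 /\ b = 0 by lia.
  by rewrite nqyt_hook_box // /hook_count a_eq0 b_eq0 /invfz /= invr1 !mul1r.
rewrite nqyt_hook_rec // hook_count_rec //.
congr (_ + _); case: ifP => [gt0|le0].
- by rewrite IH //; lia.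
- by rewrite /hook_count (@invfz_neg (a - 1)) ?mulr0 ?mul0r //; lia.
- by rewrite IH //; lia.
- by rewrite /hook_count (@invfz_neg (b - 1)) ?mulr0 ?mul0r //; lia.
Qed.

Section DurfeeTwo.
Variables (R C M : nat) (a1 a2 b1 b2 : int).
Hypotheses (a2_ge0 : 0 <= a2) (a2_lt_a1 : a2 < a1) (a1C : a1 <= C).
Hypotheses (b2_ge0 : 0 <= b2) (b2_lt_b1 : b2 < b1) (b1R : b1 <= R).
Local Notation diagram := (frobenius_diagram R C).
Local Notation shape := (diagram a1 a2 b1 b2).
Local Notation first_arm := (cell_at R C 0 a1).
Local Notation second_arm := (cell_at R C 1 (a2 + 1)).
Local Notation first_leg := (cell_at R C b1 0).
Local Notation second_leg := (cell_at R C (b2 + 1) 1).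

Let first_arm_row : first_arm.1 = 0 :> int. Proof. by rewrite cell_at_row. Qed.
Let first_arm_col : first_arm.2 = a1 :> int. Proof. by rewrite cell_at_col; lia. Qed.
Let second_arm_row : second_arm.1 = 1 :> int. Proof. by rewrite cell_at_row; lia. Qed.
Let second_arm_col : second_arm.2 = a2 + 1 :> int. Proof. by rewrite cell_at_col; lia. Qed.
Let first_leg_row : first_leg.1 = b1 :> int. Proof. by rewrite cell_at_row; lia. Qed.
Let first_leg_col : first_leg.2 = 0 :> int. Proof. by rewrite cell_at_col. Qed.
Let second_leg_row : second_leg.1 = b2 + 1 :> int. Proof. by rewrite cell_at_row; lia. Qed.
Let second_leg_col : second_leg.2 = 1 :> int. Proof. by rewrite cell_at_col; lia. Qed.

Lemma frobenius_neq0 : shape != set0.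
Proof. by apply/set0Pn; exists first_arm; cell_lia. Qed.

Lemma frobenius_corner c :
  corner shape c -> c \in [:: first_arm; first_leg; second_arm; second_leg].
Proof.
have first_arm_in : first_arm \in shape by cell_lia.
have first_leg_in : first_leg \in shape by cell_lia.
have second_arm_in : second_arm \in shape by cell_lia.
have second_leg_in : second_leg \in shape by cell_lia.
case=> + right top; rewrite inE => /or4P[] c_in.
- by apply/predU1l/eqP; move: (right _ first_arm_in); cell_lia.
- by apply/predU1r/predU1l/eqP; move: (top _ first_leg_in); cell_lia.
- by apply/predU1r/predU1r/predU1l/eqP; move: (right _ second_arm_in); cell_lia.
- by apply/predU1r/predU1r/predU1r/predU1l/eqP; move: (top _ second_leg_in); cell_lia.
Qed.

Lemma nqyt_at_first_arm (m : int) : m <= M ->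
  nqyt_at M shape first_arm m =
  if a2 < a1 - 1 then nqyt M (diagram (a1 - 1) a2 b1 b2) m else 0.
Proof.
move=> mM; case: ifP => arm_lt; last by apply: (@nqyt_at_eq0 _ _ _ _ _ second_arm); cell_lia.
have erase : shape :\ first_arm = diagram (a1 - 1) a2 b1 b2 by apply/setP=> x; cell_lia.
rewrite nqyt_at_last_col ?erase //; first by corner_lia.
  by apply/set0Pn; exists first_leg; cell_lia.
by move=> x; cell_lia.
Qed.

Lemma nqyt_at_first_leg (m : int) : m <= M ->
  nqyt_at M shape first_leg m =
  if b2 < b1 - 1 then nqyt M (diagram a1 a2 (b1 - 1) b2) (m - 1) else 0.
Proof.
move=> mM; case: ifP => leg_lt; last by apply: (@nqyt_at_eq0 _ _ _ _ _ second_leg); cell_lia.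
have erase : shape :\ first_leg = diagram a1 a2 (b1 - 1) b2 by apply/setP=> x; cell_lia.
by rewrite nqyt_at_first_col ?erase //; [corner_lia | lia].
Qed.

Lemma nqyt_at_second_arm (m : int) : m <= M -> (a2 != 0) || (b2 != 0) ->
  nqyt_at M shape second_arm m =
  if 0 < a2 then
    nqyt M (diagram (a1 - 1) (a2 - 1) b1 b2) (m - 1) + nqyt M (diagram a1 (a2 - 1) b1 b2) m
    - nqyt M (diagram (a1 - 1) (a2 - 1) b1 b2) m
  else 0.
Proof.
move=> mM outer; case: ifP => a2_gt0; last first.
  by apply: (@nqyt_at_eq0 _ _ _ _ _ second_leg); cell_lia.
have erase_second : shape :\ second_arm = diagram a1 (a2 - 1) b1 b2.
  by apply/setP=> x; cell_lia.
have erase_first : diagram a1 (a2 - 1) b1 b2 :\ first_arm = diagram (a1 - 1) (a2 - 1) b1 b2.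
  by apply/setP=> x; cell_lia.
rewrite (nqyt_at_next_to_last_col (a := first_arm)) ?erase_second ?erase_first //.
- by corner_lia.
- by corner_lia.
- by lia.
- by move=> x; cell_lia.
- by apply/set0Pn; exists first_leg; cell_lia.
- by move=> x; cell_lia.
Qed.

Lemma nqyt_at_second_leg (m : int) : m <= M -> (a2 != 0) || (b2 != 0) ->
  nqyt_at M shape second_leg m =
  if 0 < b2 then
    nqyt M (diagram a1 a2 b1 (b2 - 1)) (m - 1)
    - nqyt M (diagram a1 a2 (b1 - 1) (b2 - 1)) (m - 1 - 1)
    + nqyt M (diagram a1 a2 (b1 - 1) (b2 - 1)) (m - 1)
  else 0.
Proof.
move=> mM outer; case: ifP => b2_gt0; last first.
  by apply: (@nqyt_at_eq0 _ _ _ _ _ second_arm); cell_lia.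
have erase_second : shape :\ second_leg = diagram a1 a2 b1 (b2 - 1).
  by apply/setP=> x; cell_lia.
have erase_first : diagram a1 a2 b1 (b2 - 1) :\ first_leg = diagram a1 a2 (b1 - 1) (b2 - 1).
  by apply/setP=> x; cell_lia.
rewrite (nqyt_at_second_col (b := first_leg)) ?erase_second ?erase_first //.
- by corner_lia.
- by corner_lia.
- by lia.
- by lia.
Qed.

Lemma nqyt_at_inner_corner (m : int) : m <= M -> a2 = 0 -> b2 = 0 ->
  nqyt_at M shape second_arm m =
  nqyt M (hook R C a1 b1) (m - 1) - nqyt M (hook R C a1 (b1 - 1)) (m - 1 - 1)
  + nqyt M (hook R C a1 (b1 - 1)) (m - 1).
Proof.
move=> mM a2_eq0 b2_eq0.
have erase_second : shape :\ second_arm = hook R C a1 b1 by apply/setP=> x; cell_lia.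
have erase_first : hook R C a1 b1 :\ first_leg = hook R C a1 (b1 - 1).
  by apply/setP=> x; cell_lia.
rewrite (nqyt_at_second_col (b := first_leg)) ?erase_second ?erase_first //.
- by corner_lia.
- by corner_lia.
- by lia.
- by lia.
Qed.

Lemma nqyt_frobenius_sum (m : int) : (a2 != 0) || (b2 != 0) ->
  nqyt M shape m =
  nqyt_at M shape first_arm m + nqyt_at M shape first_leg m +
  nqyt_at M shape second_leg m + nqyt_at M shape second_arm m.
Proof.
move=> outer; rewrite (nqyt_corners _ _ frobenius_neq0 _ frobenius_corner).
  by rewrite !big_cons big_nil; ring.
by rewrite !cons_uniq andbT; cell_lia.
Qed.

Lemma nqyt_frobenius_inner_sum (m : int) : a2 = 0 -> b2 = 0 ->
  nqyt M shape m =
  nqyt_at M shape first_arm m + nqyt_at M shape first_leg m + nqyt_at M shape second_arm m.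
Proof.
move=> a2_eq0 b2_eq0.
rewrite (nqyt_corners _ (s := [:: first_arm; first_leg; second_arm]) _ frobenius_neq0).
- by rewrite !big_cons big_nil; ring.
- by rewrite !cons_uniq andbT; cell_lia.
- by move=> c /frobenius_corner; cell_lia.
Qed.

End DurfeeTwo.

Lemma nqyt_frobenius (R C M : nat) (a1 a2 b1 b2 m e : int) :
  0 <= a2 -> a2 < a1 -> a1 <= C -> 0 <= b2 -> b2 < b1 -> b1 <= R -> m <= M ->
  m + e = a1 + a2 + b1 + b2 + 2 ->
  nqyt M (frobenius_diagram R C a1 a2 b1 b2) m = frob_count a1 a2 b1 b2 (m - 1) e.
Proof.
have [n] := ubnP (absz (a1 + a2 + b1 + b2)); elim: n a1 a2 b1 b2 m e => // n IH.
move=> a1 a2 b1 b2 m e size_lt a2_ge0 a2_lt_a1 a1C b2_ge0 b2_lt_b1 b1R mM me.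
have at_first_arm : nqyt_at M (frobenius_diagram R C a1 a2 b1 b2) (cell_at R C 0 a1) m =
    frob_count (a1 - 1) a2 b1 b2 (m - 1) (e - 1).
  rewrite nqyt_at_first_arm //; case: ifP => arm_lt; last by rewrite frob_count_eq0 //; lia.
  by rewrite (IH _ _ _ _ _ (e - 1)) //; lia.
have at_first_leg : nqyt_at M (frobenius_diagram R C a1 a2 b1 b2) (cell_at R C b1 0) m =
    frob_count a1 a2 (b1 - 1) b2 (m - 1 - 1) e.
  rewrite nqyt_at_first_leg //; case: ifP => leg_lt; last by rewrite frob_count_eq0 //; lia.
  by rewrite (IH _ _ _ _ _ e) //; lia.
have [/andP[/eqP a2_eq0 /eqP b2_eq0]|] := boolP ((a2 == 0) && (b2 == 0)).
  rewrite nqyt_frobenius_inner_sum // at_first_arm at_first_leg nqyt_at_inner_corner //.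
  by rewrite !nqyt_hook ?a2_eq0 ?b2_eq0 1?[RHS]frob_count_inner_rec //; lia.
rewrite negb_and => outer; rewrite nqyt_frobenius_sum // at_first_arm at_first_leg.
rewrite nqyt_at_second_leg // nqyt_at_second_arm // [RHS]frob_count_rec; try lia.
congr (_ + _ + _); case: ifP => [gt0|le0].
- rewrite (IH a1 a2 b1 (b2 - 1) (m - 1) e) ?(IH a1 a2 (b1 - 1) (b2 - 1) (m - 1 - 1) e) //;
    try lia.
  by rewrite (IH _ _ _ _ _ (e - 1)) //; lia.
- by rewrite !frob_count_eq0 ?addr0 ?subr0 //; lia.
- rewrite (IH (a1 - 1) (a2 - 1) b1 b2 (m - 1) (e - 1)) ?(IH a1 (a2 - 1) b1 b2 m (e - 1)) //;
    try lia.
  by rewrite (IH _ _ _ _ _ (e - 1 - 1)) //; lia.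
- by rewrite !frob_count_eq0 ?addr0 ?subr0 //; lia.
Qed.

Lemma size_hook2 l1 l2 h1 h2 : (2 <= h2)%N -> (h2 <= h1)%N ->
  size (hook2 l1 l2 h1 h2) = h1.
Proof. by move=> ? ?; rewrite /hook2 /= size_cat !size_nseq; lia. Qed.

Lemma in_shape_hook2 l1 l2 h1 h2 i j :
  (2 <= l2)%N -> (l2 <= l1)%N -> (2 <= h2)%N -> (h2 <= h1)%N ->
  in_shape (hook2 l1 l2 h1 h2) i j =
    [|| (i == 0%N) && (j < l1)%N, (i == 1%N) && (j < l2)%N,
        (j == 0%N) && (i < h1)%N | (j == 1%N) && (i < h2)%N].
Proof.
move=> l2_ge2 l21 h2_ge2 h21; rewrite /in_shape size_hook2 //.
case: i => [|[|i]] /=; [lia | lia |].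
rewrite nth_cat !nth_nseq size_nseq.
by case: ifP => i_h2; case: ifP => i_h1; lia.
Qed.

Lemma QYT_eq_card_frob_count (l1 l2 h1 h2 m : nat) :
  (2 <= l2)%N -> (l2 <= l1)%N -> (2 <= h2)%N -> (h2 <= h1)%N ->
  (0 < m <= l1 + l2 + h1 + h2 - 4)%N ->
  (QYT_eq_card (hook2 l1 l2 h1 h2) m)%:R =
    frob_count (l1 - 1)%N (l2 - 2)%N (h1 - 1)%N (h2 - 2)%N (m - 1)%N
      (l1 + l2 + h1 + h2 - 4 - m)%N.
Proof.
case: l1 => [|C] l2_ge2 l21 h2_ge2 h21 m_bounds; first by lia.
have size_h1 := size_hook2 C.+1 l2 h2_ge2 h21.
have -> : (m - 1)%N = m%:Z - 1 :> int by lia.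
rewrite -(@nqyt_frobenius (size (hook2 C.+1 l2 h1 h2)).-1 C m); try lia.
rewrite nqytE; congr _%:R; apply: eq_card => T; rewrite !inE is_QYT_eqE; last by lia.
congr (qyt _ m T); apply/setP=> -[[i i_lt] [j j_lt]].
by rewrite !inE /ins in_shape_hook2 //=; lia.
Qed.

Theorem theorem4p1 (l1 l2 h1 h2 m : nat) :
  (l1 >= l2)%N -> (l2 >= 2)%N -> (h1 >= h2)%N -> (h2 >= 2)%N ->
  (h1 <= m)%N -> (m <= (l1 + l2 + h1 + h2 - 4) - (l1 - 1))%N ->
  (QYT_eq_card (hook2 l1 l2 h1 h2) m)%:R =
    ((l1 - l2 + 1)%:R / (m - h2 + 1)%:R) *
    ('C(l1 + h1 - 2, m - h2))%:R * ('C(l2 + h1 - 3, m - h2))%:R *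
    ('C(m - h2, m - h1))%:R * ('C(l2 + h2 - 4, h2 - 2))%:R *
    ('C(l1 + h2 - 3, h2 - 2))%:R / ('C(h1 - 1, h2 - 2))%:R :> rat.
Proof.
move=> l21 l2_ge2 h21 h2_ge2 h1m mn.
rewrite QYT_eq_card_frob_count ?frob_count_binomial; try lia.
by congr (_%:R / _%:R * 'C(_, _)%:R * 'C(_, _)%:R * 'C(_, _)%:R * 'C(_, _)%:R *
  'C(_, _)%:R / 'C(_, _)%:R); lia.
Qed.
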